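(* There exists a family $\mathcal F_0$ of $3$ axis-parallel rectangles such that $\pi_L(\mathcal F_0)\ge \frac{36}{31}\,\pi(\mathcal F_0)$.
   Context: For a finite family $\mathcal F$ of closed axis-parallel rectangles in the plane, a point set $P\subset\mathbb R^2$ is $\mathcal F$-piercing if every translate of every rectangle in $\mathcal F$ contains a point of $P$. The density of a point set $P$ is $\limsup_{r\to\infty} |P\cap[-r,r]^2|/(2r)^2$. $\pi(\mathcal F)$ is the infimum of the densities of $\mathcal F$-piercing point sets, and $\pi_L(\mathcal F)$ is the infimum of the densities of $\mathcal F$-piercing lattices, where a lattice $\{iu+jv:i,j\in\mathbb Z\}$ ($u,v$ linearly independent) has density $1/|\det[u,v]|$. *)

(* Defs.v *)
From mathcomp Require Import all_boot all_order all_algebra.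
From mathcomp Require Import finmap.
From mathcomp Require Import all_classical all_reals ereal.
Set Implicit Arguments. Unset Strict Implicit. Unset Printing Implicit Defensive.
Import Order.TTheory GRing.Theory Num.Theory.
Local Open Scope classical_set_scope.
Local Open Scope ring_scope.

Section Piercing.
Variable R : realType.
Notation pt := (R * R)%type.

Definition closed_rect (a b c d : R) : set pt :=
  [set p | a <= p.1 <= c /\ b <= p.2 <= d].

Definition is_rect (A : set pt) : Prop :=
  exists a b c d : R, a < c /\ b < d /\ A = closed_rect a b c d.

Definition translate (A : set pt) (t : pt) : set pt :=
  [set (p.1 + t.1, p.2 + t.2) | p in A].

Definition piercing (F : set (set pt)) (P : set pt) : Prop :=
  forall A, F A -> forall t : pt, exists2 p, P p & translate A t p.

Definition ecard (A : set pt) : \bar R :=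
  if pselect (finite_set A) then ((#|` fset_set A|%fset)%:R)%:E else +oo%E.

Definition square (r : R) : set pt := closed_rect (- r) (- r) r r.

(* density = limsup_{r -> oo} |P cap [-r,r]^2| / (2r)^2 *)
Definition density (P : set pt) : \bar R :=
  ereal_inf [set ereal_sup [set (ecard (P `&` square r) * ((2 * r) ^+ 2)^-1%:E)%E
                             | r in [set r : R | M <= r]]
            | M in [set M : R | 0 < M]].

Definition lattice (u v : pt) : set pt :=
  [set p | exists i j : int, p = (i%:~R * u.1 + j%:~R * v.1, i%:~R * u.2 + j%:~R * v.2)].

Definition det2 (u v : pt) : R := u.1 * v.2 - u.2 * v.1.

Definition pi_dens (F : set (set pt)) : \bar R :=
  ereal_inf [set density P | P in [set P | piercing F P]].

(* pi_L(F): infimum of densities 1/|det[u,v]| of F-piercing lattices *)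
Definition piL_dens (F : set (set pt)) : \bar R :=
  ereal_inf [set ((`|det2 uv.1 uv.2|)^-1)%:E
            | uv in [set uv : pt * pt | det2 uv.1 uv.2 != 0 /\ piercing F (lattice uv.1 uv.2)]].

End Piercing.

(* Main.v *)
Require Import Defs.
From mathcomp Require Import all_boot all_order all_algebra finmap.
From mathcomp Require Import all_classical all_reals ereal.
From mathcomp Require Import zify ring lra.
Set Implicit Arguments. Unset Strict Implicit. Unset Printing Implicit Defensive.
Import Order.TTheory GRing.Theory Num.Theory.
Local Open Scope classical_set_scope.
Local Open Scope ring_scope.

(* The family consists of the boxes 1 x 6, 6 x 1 and 3 x 3.

   The points (m, n) of Z^2 with n = s(m) mod 6, where s is the permutation
   0, 2, 4, 1, 3, 5 of the residues mod 6, pierce it with density 1/6.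

   Let a lattice of cell area D > 3 pierce the family.  Piercing the 1 x 6 boxes
   yields a basis p, q (p in the first quadrant, q in the fourth) of widths x, y
   with x + y <= 1 and heights at most 6; piercing the 6 x 1 boxes yields a basis
   P, Q of heights u, v with u + v <= 1 and widths at most 6.  Then
   P = a p + b q and Q = c p + d q with natural numbers a d - b c = 1, and
   D = x (c u + a v) + y (d u + b v).
   If b >= 7, then b D = (a x + b y) (d u + b v) - x u <= 36, and if a >= 8, then
   a D = (a x + b y) (c u + a v) + y u <= 37; the case a = 7 is a refinement, c
   and d are symmetric, and if all entries are at most 5, then D <= 5.  The few
   matrices left, with largest entry 6, are the near-diagonal lattices; if
   D > 31/6 they miss a 3 x 3 box. *)

(** * Bounding the cell area of a base change *)

Section BaseChange.
Variable R : realType.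
Implicit Types x y u v : R.

(* [x], [y] are the widths of [p], [q] and [u], [v] the heights of
   [P = a p + b q], [Q = c p + d q]; the heights of [p], [q] are then
   [d u + b v] and [c u + a v]. *)
Record base_change (a b c d : nat) x y u v : Prop := BaseChange {
  bc_det : (a * d = b * c + 1)%N;
  bc_x : 0 <= x; bc_y : 0 <= y; bc_u : 0 <= u; bc_v : 0 <= v;
  bc_xy : x + y <= 1; bc_uv : u + v <= 1;
  bc_P : a%:R * x + b%:R * y <= 6; bc_Q : c%:R * x + d%:R * y <= 6;
  bc_p : d%:R * u + b%:R * v <= 6; bc_q : c%:R * u + a%:R * v <= 6 }.

Definition cell (a b c d : nat) x y u v : R :=
  x * (c%:R * u + a%:R * v) + y * (d%:R * u + b%:R * v).

(* Either side of the largest empty box spanned by a basis [i p + j q],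
   [k p + l q] in the first and fourth quadrants is at most 3. *)
Definition square_pierced (a b c d : nat) x y u v : Prop :=
  let p := d%:R * u + b%:R * v in let q := c%:R * u + a%:R * v in
  forall i j k l : nat, (i * l = j * k + 1)%N ->
    0 <= i%:R * p - j%:R * q -> 0 <= l%:R * q - k%:R * p ->
    (i%:R * x + j%:R * y) + (k%:R * x + l%:R * y) <= 3 \/
    (i%:R * p - j%:R * q) + (l%:R * q - k%:R * p) <= 3.

(** Reflection in the horizontal axis exchanges [p] with [q] and [P] with [Q]. It lets [cell_le]
    reduce large [d] and [c] to large [a] and [b]. *)
Lemma base_change_mirror a b c d x y u v :
  base_change a b c d x y u v -> base_change d c b a y x v u.
Proof. by case=> *; split; rewrite // 1?addrC //; lia. Qed.

Lemma cell_mirror a b c d x y u v : cell d c b a y x v u = cell a b c d x y u v.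
Proof. rewrite /cell; ring. Qed.

Lemma square_pierced_mirror a b c d x y u v :
  square_pierced a b c d x y u v -> square_pierced d c b a y x v u.
Proof.
move=> H p q i j k l il hp hq; have lk : (l * i = k * j + 1)%N by lia.
have [||h|h] := H l k j i lk.
- by move: hq; rewrite /p /q; lra.
- by move: hp; rewrite /p /q; lra.
- by left; lra.
- by right; rewrite /p /q; lra.
Qed.

Lemma cell_le_offdiag a b c d x y u v :
  base_change a b c d x y u v -> (7 <= b)%N -> cell a b c d x y u v <= 31 / 6.
Proof.
case=> det x0 y0 u0 v0 _ _ hP _ hp _ b7.
have det' : a%:R * d%:R = b%:R * c%:R + 1 :> R by rewrite -!natrM det natrD.
have bR : 7 <= b%:R :> R by rewrite (ler_nat R 7).
have E : b%:R * cell a b c d x y u v =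
   (a%:R * x + b%:R * y) * (d%:R * u + b%:R * v) - x * u.
  have -> : x * u = (a%:R * d%:R - b%:R * c%:R) * (x * u) by rewrite det'; ring.
  by rewrite /cell; ring.
have le36 : (a%:R * x + b%:R * y) * (d%:R * u + b%:R * v) <= 6 * 6 :> R.
  by apply: ler_pM => //; rewrite addr_ge0 ?mulr_ge0.
have xu : 0 <= x * u by rewrite mulr_ge0.
rewrite leNgt; apply/negP => lt.
have : 7 * cell a b c d x y u v <= b%:R * cell a b c d x y u v.
  by apply: ler_wpM2r => //; lra.
lra.
Qed.

Lemma cell_diagE a b c d x y u v : (a * d = b * c + 1)%N ->
  a%:R * cell a b c d x y u v =
  (a%:R * x + b%:R * y) * (c%:R * u + a%:R * v) + y * u.
Proof.
move=> det.
have det' : a%:R * d%:R = b%:R * c%:R + 1 :> R by rewrite -!natrM det natrD.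
have -> : y * u = (a%:R * d%:R - b%:R * c%:R) * (y * u) by rewrite det'; ring.
by rewrite /cell; ring.
Qed.

Lemma cell_le_diag a b c d x y u v :
  base_change a b c d x y u v -> (8 <= a)%N -> cell a b c d x y u v <= 31 / 6.
Proof.
case=> det x0 y0 u0 v0 xy uv hP _ _ hq a8.
have aR : 8 <= a%:R :> R by rewrite (ler_nat R 8).
have E := cell_diagE x y u v det.
have le36 : (a%:R * x + b%:R * y) * (c%:R * u + a%:R * v) <= 6 * 6 :> R.
  by apply: ler_pM => //; rewrite addr_ge0 ?mulr_ge0.
have yu : y * u <= 1 * 1 by apply: ler_pM => //; lra.
rewrite leNgt; apply/negP => lt.
have : 8 * cell a b c d x y u v <= a%:R * cell a b c d x y u v.
  by apply: ler_wpM2r => //; lra.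
lra.
Qed.

(** With [Y = s y] and [U = t u] it suffices to bound [6 X V + Y U], which is linear in [(X, Y)] and
    in [(V, U)]. On the two quadrilaterals it is largest at the vertices [X = V = 6], [Y = U = 1],
    with value 217. The bound is 7 times [31 / 6]. *)
Lemma bilinear_le (X V y u : R) (s t : R) :
  0 <= X <= 6 -> 0 <= V <= 6 -> 0 <= y -> 0 <= u -> 0 < s -> 0 < t -> 6 <= s * t ->
  X + s * y <= 7 -> V + t * u <= 7 -> X * V + y * u <= 217 / 6.
Proof.
move=> /andP[X0 X6] /andP[V0 V6] y0 u0 s0 t0 st hX hV.
pose Y := s * y; pose U := t * u.
have Y0 : 0 <= Y by rewrite mulr_ge0 // ltW.
have U0 : 0 <= U by rewrite mulr_ge0 // ltW.
have yu : 6 * (y * u) <= Y * U.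
  have -> : Y * U = (s * t) * (y * u) by rewrite /Y /U; ring.
  by apply: ler_wpM2r => //; rewrite mulr_ge0.
rewrite -/Y -/U in hX hV.
suff : 6 * (X * V) + Y * U <= 217 by lra.
have h1 : 0 <= (6 - X) * (6 - V) by rewrite mulr_ge0 ?subr_ge0.
have h2 : 0 <= (7 - X - Y) * U by rewrite mulr_ge0 //; lra.
have h3 : 0 <= (7 - V - U) * Y by rewrite mulr_ge0 //; lra.
have h4 : 0 <= (7 - X - Y) * V by rewrite mulr_ge0 //; lra.
have h5 : 0 <= (7 - V - U) * X by rewrite mulr_ge0 //; lra.
case: (lerP Y 1) => Y1; case: (lerP U 1) => U1; nra.
Qed.

(* Modulo 7, [(7 - b) * (7 - c)] is [b * c = 7 * d - 1], hence at least 6. *)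
Lemma cell_le_diag7 b c d x y u v :
  base_change 7 b c d x y u v -> (b < 7)%N -> (c < 7)%N ->
  cell 7 b c d x y u v <= 31 / 6.
Proof.
case=> det x0 y0 u0 v0 xy uv hP _ _ hq b7 c7.
have E := cell_diagE x y u v det.
suff : (7%:R * x + b%:R * y) * (c%:R * u + 7%:R * v) + y * u <= 217 / 6.
  by rewrite -E; lra.
have sub7 (n : nat) : (n < 7)%N -> (7 - n)%:R = 7 - n%:R :> R.
  by move=> n7; rewrite natrB // ltnW.
(* This choice of [s] and [t] turns the last two conditions into [7 (x + y) <= 7] and
   [7 (u + v) <= 7]. *)
apply: (@bilinear_le _ _ _ _ (7 - b)%:R (7 - c)%:R) => //.
- by rewrite hP andbT addr_ge0 ?mulr_ge0.
- by rewrite hq andbT addr_ge0 ?mulr_ge0.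
- by rewrite ltr0n subn_gt0.
- by rewrite ltr0n subn_gt0.
- rewrite -natrM (ler_nat R 6).
  have : (0 < (7 - b) * (7 - c))%N by rewrite muln_gt0 !subn_gt0 b7.
  have : (7 %| ((7 - b) * (7 - c)).+1)%N.
    have -> : (((7 - b) * (7 - c)).+1 = 7 * (d + 7 - b - c))%N by nia.
    exact: dvdn_mulr.
  by move: (_ * _)%N => m /dvdnP[k]; lia.
- by rewrite sub7 //; lra.
- by rewrite sub7 //; lra.
Qed.

Lemma cell_le_5 a b c d x y u v :
  base_change a b c d x y u v ->
  (a <= 5)%N -> (b <= 5)%N -> (c <= 5)%N -> (d <= 5)%N ->
  cell a b c d x y u v <= 31 / 6.
Proof.
case=> det x0 y0 u0 v0 xy uv _ _ _ _ a5 b5 c5 d5.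
have le5 (m n : nat) : (m <= 5)%N -> (n <= 5)%N -> m%:R * u + n%:R * v <= 5.
  move=> m5 n5; apply: (@le_trans _ _ (5 * u + 5 * v)); last by lra.
  by apply: lerD; apply: ler_wpM2r => //; rewrite (ler_nat R _ 5).
rewrite /cell; apply: (@le_trans _ _ (x * 5 + y * 5)); last by lra.
by apply: lerD; apply: ler_wpM2l => //; apply: le5.
Qed.

(** Modulo 6 the determinant condition reads [a d = 1], which leaves [a = d = 1] and [a = d = 5]. *)
Lemma cell_le_6offdiag a b c d x y u v :
  base_change a b c d x y u v -> square_pierced a b c d x y u v ->
  b = 6%N -> (a <= 6)%N -> (d <= 6)%N -> cell a b c d x y u v <= 31 / 6.
Proof.
case=> det x0 y0 u0 v0 xy uv _ _ _ _ H b6 a6 d6.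
have : [/\ a = 1, c = 0 & d = 1]%N \/ [/\ a = 5, c = 4 & d = 5]%N.
  move: a6 det; rewrite b6 {H}.
  case: a => [|[|[|[|[|[|[|a]]]]]]] // _ det; try lia.
    by left; split; lia.
  by right; split; lia.
rewrite /cell; case=> -[ea ec ed]; move: H; subst a b c d => H;
  rewrite leNgt; apply/negP => lt.
(* The cell area is [u (c x + d y) + v (a x + b y)] with [u + v <= 1], so it is at most the larger
   coefficient; [hu] follows in the same way from [x + y <= 1]. The sides of the chosen empty box
   fall short of the quantities in [hx] and [hu] by at most 2, and [31 / 6 - 2 > 3]. *)
- have hx : x + 6 * y >= 31 / 6 by nra.
  have hu : u + 6 * v >= 31 / 6 by nra.
  by have [|||] := H 1 3 0 1 erefl; lra.
- have hx : 5 * x + 6 * y >= 31 / 6 by nra.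
  have hu : 5 * u + 6 * v >= 31 / 6 by nra.
  by have [|||] := H 1 1 2 3 erefl; lra.
Qed.

(** Here [b c = -1] modulo 6, so [b] and [c] are 1 and 5 in some order. The chosen empty boxes again
    have sides at least [31 / 6 - 2]. *)
Lemma cell_le_6diag a b c d x y u v :
  base_change a b c d x y u v -> square_pierced a b c d x y u v ->
  a = 6%N -> (b <= 6)%N -> (c <= 6)%N -> cell a b c d x y u v <= 31 / 6.
Proof.
case=> det x0 y0 u0 v0 xy uv _ _ _ _ H a6 b6 c6.
have : [/\ b = 1, c = 5 & d = 1]%N \/ [/\ b = 5, c = 1 & d = 1]%N.
  move: b6 det; rewrite a6 {H}.
  case: b => [|[|[|[|[|[|[|b]]]]]]] // _ det; try lia.
    by left; split; lia.
  by right; split; lia.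
rewrite /cell; case=> -[eb ec ed]; move: H; subst a b c d => H;
  rewrite leNgt; apply/negP => lt.
- have hx : 6 * x + y >= 31 / 6 by nra.
  have hu : 5 * u + 6 * v >= 31 / 6 by nra.
  by have [|||] := H 1 0 3 1 erefl; lra.
- have hx : 6 * x + 5 * y >= 31 / 6 by nra.
  have hu : u + 6 * v >= 31 / 6 by nra.
  by have [|||] := H 3 2 1 1 erefl; lra.
Qed.

Lemma cell_le a b c d x y u v :
  base_change a b c d x y u v -> square_pierced a b c d x y u v ->
  cell a b c d x y u v <= 31 / 6.
Proof.
move=> B S; have B' := base_change_mirror B; have S' := square_pierced_mirror S.
case: (leqP 7 b) => b7; first exact: cell_le_offdiag.
case: (leqP 7 c) => c7; first by rewrite -cell_mirror; exact: cell_le_offdiag.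
case: (leqP 8 a) => a8; first exact: cell_le_diag.
case: (leqP 8 d) => d8; first by rewrite -cell_mirror; exact: cell_le_diag.
have [a7|a7] := eqVneq a 7%N; first by subst a; apply: cell_le_diag7.
have [d7|d7] := eqVneq d 7%N.
  by subst d; rewrite -cell_mirror; apply: cell_le_diag7.
have [b6|b6] := eqVneq b 6%N; first by apply: cell_le_6offdiag => //; lia.
have [c6|c6] := eqVneq c 6%N.
  by rewrite -cell_mirror; apply: cell_le_6offdiag => //; lia.
have [a6|a6] := eqVneq a 6%N; first by apply: cell_le_6diag => //; lia.
have [d6|d6] := eqVneq d 6%N.
  by rewrite -cell_mirror; apply: cell_le_6diag => //; lia.
by apply: cell_le_5 => //; lia.
Qed.

End BaseChange.

(** * Planar lattices that pierce boxes *)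

Section Lattice.
Variable R : realType.
Implicit Types (a b c d : R) (z r s p q e f : R * R).

Lemma translate_rect a b c d t z :
  translate (closed_rect a b c d) t z <->
  (a + t.1 <= z.1 <= c + t.1 /\ b + t.2 <= z.2 <= d + t.2).
Proof.
split=> [[w [/andP[? ?] /andP[? ?]] <-]|[/andP[? ?] /andP[? ?]]] /=.
  by rewrite !lerD2r; split; apply/andP.
exists (z.1 - t.1, z.2 - t.2); last by rewrite /= !subrK -surjective_pairing.
by split; apply/andP; split=> /=; lra.
Qed.

Lemma seq_argmin (T : eqType) (F : T -> R) (P : pred T) (s : seq T) (w : T) :
  w \in s -> P w ->
  exists z : T, [/\ z \in s, P z & forall z' : T, z' \in s -> P z' -> F z <= F z'].
Proof.
move=> ws Pw; have {ws Pw} : [seq z <- s | P z] != [::].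
  by rewrite -has_filter; apply/hasP; exists w.
suff H (t : seq T) : t != [::] ->
    exists2 z : T, z \in t & forall z' : T, z' \in t -> F z <= F z'.
  case/H=> z; rewrite mem_filter => /andP[Pz zs] zmin; exists z; split=> //.
  by move=> z' z's Pz'; apply: zmin; rewrite mem_filter Pz'.
elim: t => // x [|y t] IH _.
  by exists x => [|z']; rewrite inE // => /eqP ->.
have [//|z zs zmin] := IH; have [xz|zx] := leP (F x) (F z).
  exists x; first exact: mem_head.
  by move=> z'; rewrite inE => /predU1P[->//|/zmin]; apply: le_trans.
exists z; first by rewrite inE zs orbT.
by move=> z'; rewrite inE => /predU1P[->|/zmin//]; apply: ltW.
Qed.

Lemma lattice_det e f z z' : lattice e f z -> lattice e f z' ->
  exists k : int, det2 z z' = k%:~R * det2 e f.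
Proof.
move=> [i [j ->]] [k [l ->]]; exists (i * l - j * k).
by rewrite /det2 /= intrB !intrM; ring.
Qed.

Lemma lattice_comb e f z z' (i j : int) : lattice e f z -> lattice e f z' ->
  lattice e f (i%:~R * z.1 + j%:~R * z'.1, i%:~R * z.2 + j%:~R * z'.2).
Proof.
move=> [k [l ->]] [m [n ->]]; exists (i * k + j * m), (i * l + j * n).
by rewrite /= !intrD !intrM; congr (_, _); ring.
Qed.

(** By Cramer's rule the coefficients of [z] are [det2 z f] and [det2 e z] divided by [det2 e f];
    [C] bounds both. *)
Lemma lattice_locally_finite e f (B : R) : det2 e f != 0 ->
  exists s : seq (R * R),
    forall z, lattice e f z -> `|z.1| <= B -> `|z.2| <= B -> z \in s.
Proof.
move=> D0.
pose C := B * (`|e.1| + `|e.2| + `|f.1| + `|f.2|) / `|det2 e f|.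
pose N := Num.bound `|C|.
pose ints : seq int := [seq k%:Z - N%:Z | k <- iota 0 (2 * N).+1].
have ints_mem (i : int) : `|i%:~R| <= C -> i \in ints.
  move=> iC; have : `|i%:~R| < N%:R :> R.
    apply: le_lt_trans iC (le_lt_trans (ler_norm _) _).
    exact: archi_boundP.
  rewrite -intr_norm -[N%:R]/((N%:Z)%:~R) ltr_int => iN.
  apply/mapP; exists (absz (i + N%:Z)%R); last by lia.
  by rewrite mem_iota; lia.
exists [seq (i%:~R * e.1 + j%:~R * f.1, i%:~R * e.2 + j%:~R * f.2)
       | i <- ints, j <- ints] => z [i [j ->]] h1 h2; rewrite /= in h1 h2.
apply: allpairs_f; apply: ints_mem.
- rewrite /C ler_pdivlMr ?normr_gt0 // -normrM.
  set z1 := (X in `|X| <= B) in h1; set z2 := (X in `|X| <= B) in h2.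
  have -> : i%:~R * det2 e f = z1 * f.2 - z2 * f.1.
    by rewrite /det2 /z1 /z2; ring.
  apply: le_trans (ler_normB _ _) _; rewrite !normrM.
  have : `|z1| * `|f.2| <= B * `|f.2| by apply: ler_wpM2r.
  have : `|z2| * `|f.1| <= B * `|f.1| by apply: ler_wpM2r.
  have : 0 <= B * (`|e.1| + `|e.2|).
    by rewrite mulr_ge0 ?addr_ge0 // (le_trans _ h1).
  lra.
- rewrite /C ler_pdivlMr ?normr_gt0 // -normrM.
  set z1 := (X in `|X| <= B) in h1; set z2 := (X in `|X| <= B) in h2.
  have -> : j%:~R * det2 e f = e.1 * z2 - e.2 * z1.
    by rewrite /det2 /z1 /z2; ring.
  apply: le_trans (ler_normB _ _) _; rewrite !normrM.
  have : `|e.1| * `|z2| <= `|e.1| * B by apply: ler_wpM2l.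
  have : `|e.2| * `|z1| <= `|e.2| * B by apply: ler_wpM2l.
  have : 0 <= B * (`|f.1| + `|f.2|).
    by rewrite mulr_ge0 ?addr_ge0 // (le_trans _ h1).
  lra.
Qed.

Definition pierces_box (L : set (R * R)) a b : Prop :=
  forall t, exists2 z, L z & t.1 <= z.1 <= t.1 + a /\ t.2 <= z.2 <= t.2 + b.

Section Pierced.
Variables (e f : R * R) (D0 : det2 e f != 0).
Let L := lattice e f.

(* Among the lattice points of the strip [0 < z.1 <= a], [p] is the lowest one
   above and [q] the highest one below the axis; a box of height [b] strictly
   between them would be missed. *)
Lemma lattice_adjacent a b : 0 < a -> 0 < b -> pierces_box L a b ->
  exists p q, [/\ L p, L q, 0 < p.1 <= a, 0 < q.1 <= a &
                  [/\ 0 <= p.2, q.2 < 0 & p.2 - q.2 <= b]].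
Proof.
move=> a0 b0 hL.
have [s sP] := lattice_locally_finite (a + b + 1) D0.
(* By finiteness no point of [s] has [a < z.1 <= a + eps]. A closed box shifted right by [eps] is
   thus pierced inside the half-open strip [0 < z.1 <= a], which excludes the origin. *)
have [eps /andP[eps0 eps1] epsP] : exists2 eps : R, 0 < eps <= 1 &
    forall z, z \in s -> a < z.1 -> a + eps < z.1.
  have [/hasP[w ws aw]|/hasPn none] := boolP (has (fun z => a < z.1) s).
    have [z [zs az zmin]] := seq_argmin (P := fun z => a < z.1) (fun z => z.1) ws aw.
    exists (Num.min 1 ((z.1 - a) / 2)).
      by rewrite lt_min ge_min lexx; lra.
    move=> z' z's az'; have := zmin z' z's az'.
    have : Num.min 1 ((z.1 - a) / 2) <= (z.1 - a) / 2 by rewrite ge_min lexx orbT.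
    lra.
  by exists 1; [lra|move=> z /none/negP].
have mem_s z c : L z -> 0 <= z.1 <= a + 1 -> - (b + 1) <= c -> c <= 0 ->
    c <= z.2 <= c + b -> z \in s.
  by move=> Lz h1 hc hc' h2; apply: sP => //; rewrite ler_norml; lra.
pose mem_of z := [/\ L z, 0 < z.1 <= a & - (b + 1) <= z.2 <= b].
pose s' := [seq z <- s | `[< mem_of z >]].
have window c : - (b + 1) <= c -> c <= 0 ->
    exists2 z, z \in s' & [/\ 0 < z.1 <= a & c <= z.2 <= c + b].
  move=> hc hc'; have [z Lz /= [h1 h2]] := hL (eps, c).
  have zs : z \in s by apply: (mem_s z c) => //; lra.
  have z1 : 0 < z.1 <= a.
    apply/andP; split; first by lra.
    by rewrite leNgt; apply/negP => /(epsP _ zs); lra.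
  exists z => //; rewrite mem_filter zs andbT; apply/asboolP; split=> //; lra.
pose up z := (0 < z.1 <= a) && (0 <= z.2).
pose down z := (0 < z.1 <= a) && (z.2 < 0).
have s'P z : z \in s' -> mem_of z by rewrite mem_filter => /andP[/asboolP].
have [p [ps /andP[p1 p2] pmin]] : exists p, [/\ p \in s', up p &
    forall z, z \in s' -> up z -> p.2 <= z.2].
  have [||z zs [h1 h2]] := window 0; [lra..|].
  by apply: (seq_argmin (fun z => z.2) zs); rewrite /up h1; lra.
have [q [qs /andP[q1 q2] qmin]] : exists q, [/\ q \in s', down q &
    forall z, z \in s' -> down z -> - q.2 <= - z.2].
  have [||z zs [h1 h2]] := window (- (b + 1)); [lra..|].
  by apply: (seq_argmin (fun z => - z.2) zs); rewrite /down h1; lra.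
have [Lp _ hp] := s'P _ ps; have [Lq _ hq] := s'P _ qs.
exists p, q; split=> //; split=> //; rewrite leNgt; apply/negP => lt.
have [||z zs [h1 h2]] := window ((p.2 + q.2 - b) / 2); [lra..|].
have [z2|z2] := leP 0 z.2.
  by have := pmin z zs; rewrite /up h1 z2 => /(_ isT); lra.
by have := qmin z zs; rewrite /down h1 z2 => /(_ isT); lra.
Qed.

(** Cramer's rule: the coefficients are determinants of lattice vectors divided by plus or minus
    [det2 e f], hence integers. *)
Lemma lattice_coord p q z : L p -> L q -> L z -> `|det2 p q| = `|det2 e f| ->
  exists i j : int, z = (i%:~R * p.1 + j%:~R * q.1, i%:~R * p.2 + j%:~R * q.2).
Proof.
move=> Lp Lq Lz pq.
have pq0 : det2 p q != 0 by rewrite -normr_eq0 pq normr_eq0.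
have coord z1 z2 : L z1 -> L z2 -> exists i : int, det2 z1 z2 = i%:~R * det2 p q.
  move=> L1 L2; have [k ->] := lattice_det L1 L2.
  have /eqP := pq; rewrite eqr_norm2 => /orP[]/eqP ->.
    by exists k.
  by exists (- k); rewrite intrN mulrNN.
have [i hi] := coord _ _ Lz Lq; have [j hj] := coord _ _ Lp Lz.
exists i, j; rewrite [LHS]surjective_pairing; congr (_, _);
  apply: (mulfI pq0).
- have -> : det2 p q * z.1 = det2 z q * p.1 + det2 p z * q.1.
    by rewrite /det2; ring.
  by rewrite hi hj; ring.
- have -> : det2 p q * z.2 = det2 z q * p.2 + det2 p z * q.2.
    by rewrite /det2; ring.
  by rewrite hi hj; ring.
Qed.

(* The open box with [0] and [p + q] on its vertical sides and [p] and [q] on its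
   horizontal sides contains no lattice point. *)
Lemma lattice_empty_box a b p q : pierces_box L a b -> L p -> L q ->
  `|det2 p q| = `|det2 e f| -> 0 <= p.1 -> 0 <= q.1 -> 0 <= p.2 -> q.2 <= 0 ->
  p.1 + q.1 <= a \/ p.2 - q.2 <= b.
Proof.
move=> hL Lp Lq pq p1 q1 p2 q2.
have [|w] := leP (p.1 + q.1) a; first by left.
have [|h] := leP (p.2 - q.2) b; first by right.
(* The tested box is centred at [(p + q) / 2], inside the open empty box. *)
have [z Lz] := hL ((p.1 + q.1 - a) / 2, (p.2 + q.2 - b) / 2).
have [i [j ->]] /= := lattice_coord Lp Lq Lz pq.
case=> /andP[h1 h2] /andP[h3 h4]; exfalso.
(* Each of the four sign patterns of [i], [j] puts the point on or beyond one side of the empty box: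
   equal signs the left or right side, opposite signs the top or bottom. *)
have int_cmp (k : int) : k%:~R <= 0 :> R \/ 1 <= k%:~R :> R.
  by have [?|?] := leP k 0; [left; rewrite lerz0|right; rewrite ler1z; lia].
have [hi|hi] := int_cmp i; have [hj|hj] := int_cmp j; nra.
Qed.

End Pierced.
End Lattice.

(** * The cell area of a piercing lattice *)

Section Bound.
Variables (R : realType) (e f : R * R) (D0 : det2 e f != 0).
Let L := lattice e f.
Let D : R := `|det2 e f|.

(* Determinants of lattice vectors are integer multiples of [D]. *)
Lemma lattice_det_eq (B : R) z z' : B < 2 * D -> L z -> L z' ->
  0 < - det2 z z' <= B -> det2 z z' = - D.
Proof.
move=> BD Lz Lz' /andP[gt0 leB]; have [k hk] := lattice_det Lz Lz'.
have Dgt0 : 0 < D by rewrite normr_gt0.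
have E : - det2 z z' = `|k|%:~R * D.
  by rewrite -(gtr0_norm gt0) normrN hk normrM intr_norm.
have k0 : 0 < `|k|%:~R :> R by move: gt0; rewrite E pmulr_lgt0.
have k2 : `|k|%:~R < 2%:~R :> R by rewrite -(ltr_pM2r Dgt0) -E; lra.
rewrite ltr_int in k2; rewrite ltr0z in k0.
have k1 : `|k| = 1 by lia.
by rewrite -[LHS]opprK E k1 mul1r.
Qed.

(** For the adjacent points, [- det2 p q] is positive and at most 6, the area of the box. As
    [6 < 2 D], they form a basis. *)
Lemma lattice_tall_basis : 3 < D -> pierces_box L 1 6 ->
  exists p q, [/\ L p, L q, det2 p q = - D, 0 <= p.1 /\ 0 <= q.1 &
    [/\ p.1 + q.1 <= 1, 0 <= p.2 <= 6 & 0 <= - q.2 <= 6]].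
Proof.
move=> D3 hL; have [//|//|p [q [Lp Lq hp1 hq1 [hp2 hq2 hh]]]] :=
  lattice_adjacent D0 _ _ hL.
have dpq : det2 p q = - D.
  by apply: (@lattice_det_eq 6) => //; rewrite /det2; [lra|nra].
(* Replacing the wider vector by its difference with the narrower one makes the sum of the widths
   the larger old width, at most 1. The height of the difference is up to sign [p.2 - q.2], at most
   6. *)
have [le|lt] := leP q.1 p.1.
- exists (1%:~R * p.1 + (-1)%:~R * q.1, 1%:~R * p.2 + (-1)%:~R * q.2), q.
  split=> //=; first exact: lattice_comb.
  + by rewrite -dpq /det2 /=; ring.
  + by split; lra.
  + by split; lra.
- exists p, (1%:~R * q.1 + (-1)%:~R * p.1, 1%:~R * q.2 + (-1)%:~R * p.2).
  split=> //=; first exact: lattice_comb.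
  + by rewrite -dpq /det2 /=; ring.
  + by split; lra.
  + by split; lra.
Qed.

Lemma lattice_wide_basis : 3 < D -> pierces_box L 6 1 ->
  exists p q, [/\ L p, L q, det2 p q = - D, 0 <= p.1 <= 6 /\ 0 <= q.1 <= 6 &
    [/\ 0 <= p.2, 0 <= - q.2 & p.2 - q.2 <= 1]].
Proof.
move=> D3 hL; have [//|//|p [q [Lp Lq hp1 hq1 [hp2 hq2 hh]]]] :=
  lattice_adjacent D0 _ _ hL.
exists p, q; split=> //; last by split; lra.
- by apply: (@lattice_det_eq 6) => //; rewrite /det2; [lra|nra].
- by split; lra.
Qed.

Lemma int_gtN1_nat (k : int) : -1 < k%:~R :> R -> exists n : nat, k = n%:Z.
Proof. by rewrite -mulrN1z ltr_int => ?; exists (absz k); lia. Qed.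

Lemma lattice_cell_le : pierces_box L 1 6 -> pierces_box L 6 1 ->
  pierces_box L 3 3 -> D <= 31 / 6.
Proof.
move=> tall wide sq; rewrite leNgt; apply/negP => Dlt.
have D3 : 3 < D by lra.
have [p [q [Lp Lq dpq [p1 q1] [pq1 /andP[p2 p2'] /andP[q2 q2']]]]] :=
  lattice_tall_basis D3 tall.
have [P [Q [LP LQ dPQ [/andP[P1 P1'] /andP[Q1 Q1']] [P2 Q2 PQ2]]]] :=
  lattice_wide_basis D3 wide.
have npq : `|det2 p q| = D by rewrite dpq normrN normr_id.
have [al [be hP]] := lattice_coord D0 Lp Lq LP npq.
have [ga [de hQ]] := lattice_coord D0 Lp Lq LQ npq.
(* By Cramer's rule each coefficient times [D] is a determinant. Its only possible negative term is
   a width of [p] or [q] times a height of [P] or [Q], both at most 1, so the determinant is at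
   least [-1 > - D]. *)
have nonneg (k : int) : - 1 <= k%:~R * D -> exists n : nat, k = n%:Z.
  move=> h; apply: int_gtN1_nat; rewrite -(ltr_pM2r (_ : 0 < D)); lra.
have P1E : P.1 = al%:~R * p.1 + be%:~R * q.1 by rewrite {1}hP.
have P2E : P.2 = al%:~R * p.2 + be%:~R * q.2 by rewrite {1}hP.
have Q1E : Q.1 = ga%:~R * p.1 + de%:~R * q.1 by rewrite {1}hQ.
have Q2E : Q.2 = ga%:~R * p.2 + de%:~R * q.2 by rewrite {1}hQ.
have dE : D = - det2 p q by rewrite dpq opprK.
have ge_m1 (s t s' t' : R) : 0 <= s -> 0 <= t -> 0 <= s' <= 1 -> 0 <= t' <= 1 ->
    - 1 <= s * t - s' * t'.
  move=> s0 t0 /andP[s'0 s'1] /andP[t'0 t'1].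
  have st : 0 <= s * t by rewrite mulr_ge0.
  have st' : s' * t' <= 1 * 1 by apply: ler_pM.
  lra.
have p1' : 0 <= p.1 <= 1 by lra.
have q1' : 0 <= q.1 <= 1 by lra.
have P2' : 0 <= P.2 <= 1 by lra.
have Q2' : 0 <= - Q.2 <= 1 by lra.
have ge0_m1 (s t s' t' : R) : 0 <= s -> 0 <= t -> 0 <= s' -> 0 <= t' ->
    - 1 <= s * t + s' * t'.
  by move=> *; rewrite (@le_trans _ _ 0) ?lerN10 ?addr_ge0 ?mulr_ge0.
have [a ea] : exists n : nat, al = n%:Z.
  apply: nonneg; have -> : al%:~R * D = P.2 * q.1 + P.1 * - q.2.
    by rewrite dE /det2 P1E P2E; ring.
  exact: ge0_m1.
have [b eb] : exists n : nat, be = n%:Z.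
  apply: nonneg; have -> : be%:~R * D = P.1 * p.2 - P.2 * p.1.
    by rewrite dE /det2 P1E P2E; ring.
  exact: ge_m1.
have [c ec] : exists n : nat, ga = n%:Z.
  apply: nonneg; have -> : ga%:~R * D = Q.1 * - q.2 - - Q.2 * q.1.
    by rewrite dE /det2 Q1E Q2E; ring.
  exact: ge_m1.
have [d ed] : exists n : nat, de = n%:Z.
  apply: nonneg; have -> : de%:~R * D = Q.1 * p.2 + - Q.2 * p.1.
    by rewrite dE /det2 Q1E Q2E; ring.
  exact: ge0_m1.
subst al be ga de.
have detR : a%:R * d%:R - b%:R * c%:R = 1 :> R.
  apply: (@mulIf _ (det2 p q)); first by rewrite dpq; lra.
  rewrite mul1r {2}dpq -dPQ /det2 P1E P2E Q1E Q2E; ring.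
have det : (a * d = b * c + 1)%N.
  apply/eqP; rewrite -(eqr_nat R) natrD !natrM; apply/eqP; lra.
have p2E : d%:R * P.2 + b%:R * - Q.2 = p.2.
  have -> : p.2 = (a%:R * d%:R - b%:R * c%:R) * p.2 by rewrite detR mul1r.
  by rewrite P2E Q2E; ring.
have q2E : c%:R * P.2 + a%:R * - Q.2 = - q.2.
  have -> : q.2 = (a%:R * d%:R - b%:R * c%:R) * q.2 by rewrite detR mul1r.
  by rewrite P2E Q2E; ring.
have bc : base_change a b c d p.1 q.1 P.2 (- Q.2).
  by split=> //; rewrite ?p2E ?q2E // -?P1E -?Q1E.
have : cell a b c d p.1 q.1 P.2 (- Q.2) <= 31 / 6.
  apply: cell_le => //; rewrite /square_pierced p2E q2E => i j k l il h1 h2.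
  have Lc (m n : nat) : L (m%:R * p.1 + n%:R * q.1, m%:R * p.2 + n%:R * q.2).
    exact: (lattice_comb m n Lp Lq).
  have ilR : i%:R * l%:R = j%:R * k%:R + 1 :> R by rewrite -!natrM il natrD.
  have [|||||H|H] := lattice_empty_box D0 sq (Lc i j) (Lc k l).
  - rewrite -/D -npq; congr `|_|; rewrite /det2 /=.
    have -> : p.1 * q.2 - p.2 * q.1 =
        (i%:R * l%:R - j%:R * k%:R) * (p.1 * q.2 - p.2 * q.1) by rewrite ilR; ring.
    by ring.
  - by rewrite /= addr_ge0 ?mulr_ge0.
  - by rewrite /= addr_ge0 ?mulr_ge0.
  - by rewrite /=; lra.
  - by rewrite /=; lra.
  - by left.
  - by right; rewrite /= in H; lra.
by rewrite /cell p2E q2E; move: dpq; rewrite /det2; lra.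
Qed.

End Bound.

(** * The periodic point set and its density *)

Definition perm6 (i : nat) : nat := nth 0%N [:: 0; 2; 4; 1; 3; 5]%N i.

(** By periodicity only window corners modulo 6 matter, so piercing becomes a boolean that
    evaluation decides. *)
Definition meets_windows (A B : nat) : bool :=
  all (fun i => all (fun j =>
    has (fun s => has (fun t => perm6 ((i + s) %% 6) == (j + t) %% 6)%N
      (iota 0 B)) (iota 0 A)) (iota 0 6)) (iota 0 6).

Lemma meets_windowsP (A B : nat) (m n : int) : meets_windows A B ->
  exists s t i : nat, exists k l : int,
    [/\ (s < A)%N, (t < B)%N, (i < 6)%N &
        m + s%:Z = 6 * k + i%:Z /\ n + t%:Z = 6 * l + (perm6 i)%:Z].
Proof.
have residue (k : int) : exists (r : nat) (q : int), (r < 6)%N /\ k = 6 * q + r%:Z.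
  by exists (absz (k %% 6)%Z), (k %/ 6)%Z; split; lia.
have [i [k [i6 ->]]] := residue m; have [j [l [j6 ->]]] := residue n.
move=> /allP/(_ i); rewrite mem_iota => /(_ i6)/allP/(_ j).
rewrite mem_iota => /(_ j6)/hasP[s sA /hasP[t tB /eqP E]].
rewrite !mem_iota /= !add0n in sA tB.
exists s, t, ((i + s) %% 6)%N, (k + ((i + s) %/ 6)%N%:Z), (l + ((j + t) %/ 6)%N%:Z).
split=> //; first exact: ltn_pmod.
by rewrite E; split; lia.
Qed.

Section Pattern.
Variable R : realType.

Definition pattern : set (R * R) :=
  [set z | exists (i : nat) (k l : int),
     (i < 6)%N /\ z = ((6 * k + i%:Z)%:~R, (6 * l + (perm6 i)%:Z)%:~R)].

(** A closed interval of length [A] from [x] contains the [A] integers starting at the ceiling of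
    [x], so every box contains a full integer window. *)
Lemma pattern_pierces (A B : nat) :
  meets_windows A B -> pierces_box pattern A%:R B%:R.
Proof.
move=> AB t; have [s [s' [i [k [l [sA s'B i6 [E1 E2]]]]]]] :=
  meets_windowsP (Num.ceil t.1) (Num.ceil t.2) AB.
exists ((6 * k + i%:Z)%:~R, (6 * l + (perm6 i)%:Z)%:~R); first by exists i, k, l.
rewrite /= -E1 -E2.
have inbox (x : R) (w W : nat) : (w < W)%N ->
    x <= (Num.ceil x + w%:Z)%:~R <= x + W%:R.
  move=> wW; have /andP[h1 h2] := ceil_itv x.
  have wW' : w%:R + 1 <= W%:R :> R by rewrite natr1 ler_nat.
  have w0 : 0 <= w%:R :> R by [].
  by rewrite intrB in h1; rewrite intrD -pmulrn; lra.
by split; apply: inbox.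
Qed.

Lemma ecard_le_size (A : set (R * R)) (s : seq (R * R)) :
  (forall z, A z -> z \in s) -> (ecard A <= (size s)%:R%:E)%E.
Proof.
move=> As; have fA : finite_set A by apply: sub_finite_set (finite_seq s).
rewrite /ecard; case: pselect => // ?; rewrite lee_fin ler_nat.
apply: leq_trans (size_undup s); rewrite -card_fseq.
apply: fsubset_leq_card; apply/fsubsetP => z.
by rewrite in_fset_set // !inE => /As.
Qed.

Lemma block_index (K j : nat) (m : int) : (j < 6)%N ->
  - (6 * K%:Z) < 6 * m + j%:Z -> 6 * m + j%:Z < 6 * K%:Z ->
  exists n : 'I_(2 * K), m = n%:Z - K%:Z.
Proof.
move=> j6 lo hi; have nK : (absz (m + K%:Z)%R < 2 * K)%N by lia.
by exists (Ordinal nK) => /=; lia.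
Qed.

(** The square is covered by [(2 K)^2] blocks of side 6 with six points each, and
    [K <= r / 6 + 1]. *)
Lemma ecard_pattern (r : R) : 0 < r ->
  (ecard (pattern `&` square r) <= (2 / 3 * (r + 6) ^+ 2)%:E)%E.
Proof.
move=> r0; pose K := (Num.trunc (r / 6)).+1.
have /andP[K1 K2] : (Num.trunc (r / 6))%:R <= r / 6 < K%:R.
  by apply: truncn_itv; lra.
have K3 : K%:R <= r / 6 + 1.
  by rewrite (_ : K%:R = (Num.trunc (r / 6))%:R + 1) ?lerD2r // natr1.
pose g (w : 'I_6 * ('I_(2 * K) * 'I_(2 * K))) : R * R :=
  ((6 * (w.2.1%:Z - K%:Z) + w.1%:Z)%:~R,
   (6 * (w.2.2%:Z - K%:Z) + (perm6 w.1)%:Z)%:~R).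
apply: (@le_trans _ _ ((size [seq g w | w : 'I_6 * ('I_(2 * K) * 'I_(2 * K))])%:R%:E)).
  apply: ecard_le_size => z [[i [k [l [i6 ->]]]] [/= h1 h2]].
  have coord (m : int) (j : nat) : (j < 6)%N -> - r <= (6 * m + j%:Z)%:~R <= r ->
      exists n : 'I_(2 * K), m = n%:Z - K%:Z.
    move=> j6 /andP[lo hi]; apply: (block_index (j := j)) => //.
      rewrite -(ltr_int R); apply: lt_le_trans lo.
      by rewrite intrN intrM -pmulrn; lra.
    by rewrite -(ltr_int R); apply: le_lt_trans hi _; rewrite intrM -pmulrn; lra.
  have p6 : (perm6 i < 6)%N by case: (i) i6 => [|[|[|[|[|[|?]]]]]].
  have [n ->] := coord _ _ i6 h1; have [n' ->] := coord _ _ p6 h2.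
  by apply/mapP; exists (Ordinal i6, (n, n')); rewrite ?mem_enum.
rewrite size_map -cardE !card_prod !card_ord lee_fin !natrM.
have : 0 <= K%:R :> R by [].
have : K%:R * K%:R <= (r / 6 + 1) * (r / 6 + 1) by apply: ler_pM.
by rewrite expr2; lra.
Qed.

Lemma density_pattern : (density pattern <= (6^-1)%:E)%E.
Proof.
apply/lee_addgt0Pr => eps eps0; rewrite -EFinD.
(* The final estimate amounts to [8 r + 24 <= 4 eps r^2], which follows from [eps r >= 8] and
   [r >= 1]. *)
pose M : R := Num.max 1 (8 / eps).
apply: (@le_trans _ _ (ereal_sup [set (ecard (pattern `&` square r) *
    ((2 * r) ^+ 2)^-1%:E)%E | r in [set r : R | M <= r]])).
  apply: ereal_inf_lbound; exists M => //=.
  by rewrite lt_max ltr01.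
apply: ge_ereal_sup => _ [r /= Mr <-].
have r1 : 1 <= r by apply: le_trans Mr; rewrite le_max lexx.
have r2 : 8 <= eps * r.
  rewrite mulrC -ler_pdivrMr //; apply: le_trans Mr.
  by rewrite le_max lexx orbT.
have r0 : 0 < r by lra.
have rr : 0 < (2 * r) ^+ 2 by rewrite exprn_gt0 // mulr_gt0.
apply: (@le_trans _ _ ((2 / 3 * (r + 6) ^+ 2)%:E * ((2 * r) ^+ 2)^-1%:E)%E).
  by apply: lee_wpmul2r; [rewrite lee_fin invr_ge0 ltW|exact: ecard_pattern].
rewrite -EFinM lee_fin ler_pdivrMr // !expr2.
have : 8 * r <= eps * r * r by rewrite ler_pM2r.
nra.
Qed.

End Pattern.

(** * The three boxes and the ratio of densities *)

Section Family.
Variable R : realType.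
Local Notation box a b := (closed_rect (0 : R) 0 a b).

Lemma translate_boxP (a b : R) (L : set (R * R)) :
  (forall t, exists2 z, L z & translate (box a b) t z) <-> pierces_box L a b.
Proof.
have E t z : translate (box a b) t z <->
    (t.1 <= z.1 <= t.1 + a /\ t.2 <= z.2 <= t.2 + b).
  by have := translate_rect 0 0 a b t z; rewrite !add0r [a + _]addrC [b + _]addrC.
by split=> H t; have [z Lz hz] := H t; exists z => //; apply/E.
Qed.

Lemma box_neq (a b c d : R) : 0 <= a -> 0 <= b -> c < a \/ d < b ->
  box a b <> box c d.
Proof.
move=> a0 b0 lt E; have : box a b (a, b) by split=> /=; rewrite ?a0 ?b0 lexx.
by rewrite E => -[/= /andP[_ h1] /andP[_ h2]]; lra.
Qed.

End Family.

Theorem theorem5 (R : realType) :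
  exists A1 A2 A3 : set (R * R),
    [/\ is_rect A1, is_rect A2, is_rect A3 &
        [/\ A1 <> A2, A1 <> A3 & A2 <> A3]] /\
    let F0 := [set A | A = A1 \/ A = A2 \/ A = A3] in
    ((36 / 31 : R)%:E * pi_dens F0 <= piL_dens F0)%E.
Proof.
exists (closed_rect 0 0 1 6), (closed_rect 0 0 6 1), (closed_rect 0 0 3 3).
split.
  have rect (a b : R) : 0 < a -> 0 < b -> is_rect (closed_rect 0 0 a b).
    by move=> a0 b0; exists 0, 0, a, b.
  by split; [apply: rect..|split; apply: box_neq]; lra.
move=> F0.
have piercingP L : piercing F0 L <->
    [/\ pierces_box L 1 6, pierces_box L 6 1 & pierces_box L 3 3].
  split=> [H|[h1 h2 h3] A [->|[->|->]]].
  - by split; apply/translate_boxP; apply: H; [left|right; left|right; right].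
  - exact/translate_boxP.
  - exact/translate_boxP.
  - exact/translate_boxP.
have pi_le : (pi_dens F0 <= (6^-1)%:E)%E.
  apply: le_trans (density_pattern R); apply: ereal_inf_lbound.
  exists (@pattern R) => //; apply/piercingP; split.
  - exact: (@pattern_pierces R 1 6).
  - exact: (@pattern_pierces R 6 1).
  - exact: (@pattern_pierces R 3 3).
(* The middle term is [6 / 31], the density of a lattice of cell area [31 / 6]. *)
apply: (@le_trans _ _ ((36 / 31 : R)%:E * (6^-1)%:E)%E).
  by apply: lee_wpmul2l => //; rewrite lee_fin; lra.
apply: le_ereal_inf_tmp => _ [[e f] /= [D0 /piercingP[h1 h2 h3]] <-].
rewrite -EFinM lee_fin (_ : 36 / 31 * 6^-1 = (31 / 6)^-1 :> R); last by field.
by rewrite lef_pV2 ?posrE ?normr_gt0 ?divr_gt0 //; apply: lattice_cell_le.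
Qed.
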